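(* The following sets of binary strings of length $n$ are flip-swap languages. Flip-swap languages with respect to $1$: (i) all strings; (ii) strings with weight $\le k$; (iii) strings $\le\gamma$; (iv) strings with $\le k$ inversions with respect to $0^*1^*$; (v) strings with $\le k$ transpositions with respect to $0^*1^*$; (vi) strings $<$ their reversal; (vii) strings $\le$ their reversal (neckties); (viii) strings $<$ their complemented reversal; (ix) strings $\le$ their complemented reversal; (x) strings with forbidden $10^t$ (i.e. not containing the substring $10^t$); (xi) strings with forbidden prefix $1\gamma$; (xii) $0$-prefix normal words; (xiii) necklaces (smallest rotation); (xiv) Lyndon words; (xv) prenecklaces (smallest rotation); (xvi) pseudo-necklaces with respect to $0^*1^*$; (xvii) left factors of $k$-ary Dyck words; (xviii) feasible solutions to $0$-$1$ knapsack problems. Flip-swap languages with respect to $0$: (1) all strings; (2) strings with weight $\ge k$; (3) strings $\ge\gamma$; (4) strings with $\le k$ inversions with respect to $1^*0^*$; (5) strings with $\le k$ transpositions with respect to $1^*0^*$; (6) strings $>$ their reversal; (7) strings $\ge$ their reversal; (8) strings $>$ their complemented reversal; (9) strings $\ge$ their complemented reversal; (10) strings with forbidden $01^t$ (i.e. not containing the substring $01^t$); (11) strings with forbidden prefix $0\gamma$; (12) $1$-prefix normal words; (13) necklaces (largest rotation); (14) aperiodic necklaces (largest rotation); (15) prenecklaces (largest rotation); (16) pseudo-necklaces with respect to $1^*0^*$.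
   Context: A flip-swap language with respect to $1$ is a set $\mathbf S$ of binary strings of length $n$ such that $\mathbf S\cup\{0^n\}$ is closed under two operations (when applicable): (1) flip (complement) the leftmost $1$; (2) swap the leftmost $1$ with the bit to its right. A flip-swap language with respect to $0$ is defined similarly, with the roles of $0$ and $1$ interchanged. Here $k$ and $t$ are integer parameters and $\gamma$ is a binary string. Strings are written $\alpha=b_1b_2\cdots b_n$ and are compared lexicographically. The weight of $\alpha$ is the number of $1$s it contains. The complemented reversal of $\alpha$ is the bitwise complement of its reversal. An inversion in $\alpha$ with respect to $0^*1^*$ is an index pair $(i,j)$ such that $i<j$, $b_i=1$ and $b_j=0$; with respect to $1^*0^*$ the roles of $0$ and $1$ are interchanged. The number of transpositions of $\alpha$ with respect to another binary string $\beta$ of length $n$ is the minimum number of adjacent transpositions required to transform $\alpha$ to $\beta$; the number of transpositions with respect to $0^*1^*$ (resp. $1^*0^*$) is the number required to transform $\alpha$ into a string of the form $0^*1^*$ (resp. $1^*0^*$). A binary string is $0$-prefix normal (prefix normal with respect to $0$) if no substring of it has more $0$s than its prefix of the same length; $1$-prefix normal words are defined in the same way with $1$s in place of $0$s. A necklace is the lexicographically smallest (resp. largest) string in an equivalence class under rotation. An aperiodic necklace is a necklace that cannot be written in the form $\beta^j$ with $j\ge 2$. A Lyndon word is an aperiodic necklace when the lexicographically smallest string is used as the representative. A prenecklace is a prefix of a necklace. A block with respect to $0^*1^*$ is a maximal substring of the form $0^*1^*$. A block $B_i$ is represented by two integers $(s_i,t_i)$, its numbers of $0$s and $1$s respectively.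 A block $B_i=(s_i,t_i)$ is said to be lexicographically smaller than a block $B_j=(s_j,t_j)$, written $B_i<B_j$, if $s_i<s_j$, or $s_i=s_j$ and $t_i<t_j$. A string $\alpha=b_1b_2\cdots b_n=B_bB_{b-1}\cdots B_1$ (its decomposition into blocks) is a pseudo-necklace with respect to $0^*1^*$ if $B_b\le B_i$ for all $1\le i<b$. Pseudo-necklaces with respect to $1^*0^*$ are defined with the roles of $0$ and $1$ interchanged. A $k$-ary Dyck word is a binary string of length $tk$ with $t$ copies of $1$ and $t(k-1)$ copies of $0$ such that every prefix has at most $k-1$ copies of $0$ for every $1$. The set of length $n$ prefixes of $k$-ary Dyck words is called the left factors of $k$-ary Dyck words. The input to a $0$-$1$ knapsack problem is a capacity $W$ and a set of $n$ items, each with a weight $w_i\ge 0$ and a value $v_i$. The items are ordered so that $w_i\ge w_{i+1}$ for $1\le i\le n-1$. A subset of items is feasible if its total weight is at most $W$; the feasible solutions are represented by the incidence vectors of the feasible subsets.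
   Formalization: Three items are false as printed and are corrected: (xvii) is proved for Dyck words with 0 and 1 interchanged (and as printed, but with respect to 0); in (xvi) and (16), B_i<B_j means s_i>s_j (not s_i<s_j), or s_i=s_j and t_i<t_j. *)

(* Defs.v *)
(* Bits are booleans (1 = true, 0 = false); the bit argument [c] below
   lets one definition cover both a notion ([c = true]) and the notion with the
   roles of 0 and 1 interchanged ([c = false]). *)
From HB Require Import structures.
From mathcomp Require Import all_boot all_order all_algebra.

Set Implicit Arguments.
Unset Strict Implicit.
Unset Printing Implicit Defensive.

Import Order.TTheory GRing.Theory Num.Theory.

Definition flip_leftmost (c : bool) (s s' : seq bool) : Prop :=
  exists i u, s = nseq i (~~ c) ++ c :: u
           /\ s' = nseq i (~~ c) ++ ~~ c :: u.

Definition swap_leftmost (c : bool) (s s' : seq bool) : Prop :=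
  exists i b u, s = nseq i (~~ c) ++ c :: b :: u
             /\ s' = nseq i (~~ c) ++ b :: c :: u.

Definition flip_swap (c : bool) (n : nat) (S : n.-tuple bool -> Prop) : Prop :=
  let T (s : n.-tuple bool) := S s \/ s = [tuple ~~ c | _ < n] in
  (forall s s' : n.-tuple bool, T s -> flip_leftmost c s s' -> T s')
  /\ (forall s s' : n.-tuple bool, T s -> swap_leftmost c s s' -> T s').

Definition lex_le (s t : seq bool) : bool := ((s : seqlexi bool) <= t)%O.
Definition lex_lt (s t : seq bool) : bool := ((s : seqlexi bool) < t)%O.

Definition weight (s : seq bool) : nat := count_mem true s.

Definition comp_rev (s : seq bool) : seq bool := map negb (rev s).

(* With respect to 0^*1^* for c = true, and to 1^*0^* for c = false. *)
Definition inversions (c : bool) (n : nat) (s : n.-tuple bool) : nat :=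
  #|[set p : 'I_n * 'I_n |
      [&& p.1 < p.2, tnth s p.1 == c & tnth s p.2 == ~~ c]]|.

Definition adj_transp (s s' : seq bool) : Prop :=
  exists u a b v, s = u ++ a :: b :: v /\ s' = u ++ b :: a :: v.

Fixpoint transp_path (m : nat) (s t : seq bool) : Prop :=
  if m is m'.+1 then exists2 s', adj_transp s s' & transp_path m' s' t
  else s = t.

Definition transp_into (X : seq bool -> Prop) (s : seq bool) (m : nat) : Prop :=
  exists2 t, X t & transp_path m s t.

Definition num_transp (X : seq bool -> Prop) (s : seq bool) (m : nat) : Prop :=
  transp_into X s m /\ (forall m', transp_into X s m' -> m <= m').

(* The strings 0^*1^* for c = true, and 1^*0^* for c = false. *)
Definition two_runs (c : bool) (s : seq bool) : Prop :=
  exists p q, s = nseq p (~~ c) ++ nseq q c.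

Definition prefix_normal (c : bool) (s : seq bool) : Prop :=
  forall u, infix u s -> count_mem c u <= count_mem c (take (size u) s).

Definition necklace_min (s : seq bool) : Prop := forall i, lex_le s (rot i s).
Definition necklace_max (s : seq bool) : Prop := forall i, lex_le (rot i s) s.

Definition aperiodic (s : seq bool) : Prop :=
  forall (u : seq bool) (j : nat), 2 <= j -> s <> flatten (nseq j u).

Definition lyndon (s : seq bool) : Prop := necklace_min s /\ aperiodic s.

Definition prenecklace_min (s : seq bool) : Prop :=
  exists2 w, necklace_min w & prefix s w.
Definition prenecklace_max (s : seq bool) : Prop :=
  exists2 w, necklace_max w & prefix s w.

(* The pair (p, q) stands for 0^p 1^q if c = true and for 1^p 0^q if c = false. *)
Definition block_word (c : bool) (B : nat * nat) : seq bool :=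
  nseq B.1 (~~ c) ++ nseq B.2 c.

(* Blocks are maximal exactly when, of two consecutive ones, the first has
   a nonempty second run and the second has a nonempty first run. *)
Definition block_decomposition (c : bool) (s : seq bool) (Bs : seq (nat * nat))
    : Prop :=
  s = flatten (map (block_word c) Bs)
  /\ sorted (fun B B' : nat * nat => (0 < B.2) && (0 < B'.1)) Bs.

(* A longer first run makes a block smaller: 0^s 1^t precedes 0^s' 1^t' (t > 0)
   in the lexicographic order of words when s > s', or when s = s' and t < t'.
   Comparing the first runs by s < s' instead would exclude necklaces
   such as 00101 and would not give a flip-swap language: with that order 100,
   with blocks (0,1), (2,0), would qualify, but not 010, with blocks (1,1), (1,0). *)
Definition block_lt (B B' : nat * nat) : bool :=
  (B'.1 < B.1) || ((B.1 == B'.1) && (B.2 < B'.2)).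
Definition block_le (B B' : nat * nat) : bool := (B == B') || block_lt B B'.

Definition pseudo_necklace (c : bool) (s : seq bool) : Prop :=
  exists B Bs, block_decomposition c s (B :: Bs) /\ all (block_le B) Bs.

(* c = true gives the usual k-ary Dyck words, where every prefix has at most
   k - 1 copies of 0 for every 1; their left factors are a flip-swap language with
   respect to 0 but not to 1 (11 flips to 01). c = false gives the bitwise
   complements, whose left factors are a flip-swap language with respect to 1.
   For k = 0 only the empty word qualifies. *)
Definition dyck_word (c : bool) (k : nat) (w : seq bool) : Prop :=
  exists t, [/\ size w = t * k, count_mem c w = t,
                count_mem (~~ c) w = t * k.-1
              & forall u, prefix u w ->
                  count_mem (~~ c) u <= k.-1 * count_mem c u].

Definition dyck_left_factor (c : bool) (k : nat) (s : seq bool) : Prop :=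
  exists2 w, dyck_word c k w & prefix s w.

Record knapsack (R : realDomainType) (n : nat) := Knapsack {
  capacity : R;
  item_weight : 'I_n -> R;
  item_value : 'I_n -> R;
  item_weight_ge0 : forall i, (0 <= item_weight i)%R;
  item_weight_sorted : forall i j : 'I_n,
    j = i.+1 :> nat -> (item_weight j <= item_weight i)%R
}.

Definition feasible (R : realDomainType) (n : nat) (K : knapsack R n)
    (A : {set 'I_n}) : bool :=
  (\sum_(i in A) item_weight K i <= capacity K)%R.

Definition incidence (n : nat) (A : {set 'I_n}) : n.-tuple bool :=
  [tuple i \in A | i < n].

Definition feasible_solution (R : realDomainType) (n : nat) (K : knapsack R n)
    (s : n.-tuple bool) : Prop :=
  exists2 A : {set 'I_n}, feasible K A & s = incidence A.

(* Main.v *)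
(* In every string the leftmost 1 ends the initial run 0^i.  A flip or a swap of
   the leftmost 1 turns 0^i 1 u into a string with a strictly longer initial run
   of 0s, and strings with at least one 1 compare by these runs first.  So if a
   string is at most its reversal, or has no rotation with a longer initial run,
   the new string is strictly below its competitors, whose initial runs do not
   grow.  In particular a flip or a swap of a necklace is 0^n or a Lyndon word.
   The number of transpositions needed to sort a string equals its number of
   inversions.  Most languages with respect to 0 are the complements of those
   with respect to 1. *)
Require Import Defs.
From HB Require Import structures.
From mathcomp Require Import all_boot all_order all_algebra.
From mathcomp Require Import zify ring.

Set Implicit Arguments.
Unset Strict Implicit.
Unset Printing Implicit Defensive.

Import Order.TTheory GRing.Theory Num.Theory.

(** * From predicates on strings to flip-swap languages *)

(* If the leftmost bit c is the only one, flipping it gives the constant string,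
   which [flip_swap] always admits; hence the condition [c \in u]. *)
Definition fs_closed (c : bool) (P : seq bool -> Prop) : Prop :=
  (forall i (u : seq bool), c \in u -> P (nseq i (~~ c) ++ c :: u) ->
     P (nseq i (~~ c) ++ ~~ c :: u))
  /\ (forall i u, P (nseq i (~~ c) ++ c :: ~~ c :: u) ->
     P (nseq i (~~ c) ++ ~~ c :: c :: u)).

Lemma nseq_cat_cons (T : Type) (x : T) i u :
  nseq i x ++ x :: u = nseq i.+1 x ++ u.
Proof. by elim: i => //= i ->. Qed.

Lemma notin_nseq (c : bool) u : c \notin u -> u = nseq (size u) (~~ c).
Proof.
elim: u => //= x u IH; rewrite in_cons negb_or => /andP[xc /IH <-].
by move: xc; case: (x); case: (c).
Qed.

Lemma first_run (c : bool) u : c \in u ->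
  exists a w, u = nseq a (~~ c) ++ c :: w.
Proof.
elim: u => // x u IH; have [->|xc] := eqVneq x c; first by exists 0, u.
rewrite in_cons eq_sym (negPf xc) => /IH[a [w ->]]; exists a.+1, w.
by move: xc; case: (x); case: (c).
Qed.

Lemma first_run_inj (c : bool) i j u v :
  nseq i (~~ c) ++ c :: u = nseq j (~~ c) ++ c :: v -> i = j /\ u = v.
Proof.
elim: i j => [|i IH] [|j] /=; first by case.
- by case: (c).
- by case: (c).
by case=> /IH[-> ->].
Qed.

(** The constant string contains no [c], so no operation starts from it; it arises only as a target,
    when the only [c] is flipped. *)
Lemma flip_swap_closed c n (S : n.-tuple bool -> Prop) (P : seq bool -> Prop) :
  (forall s, S s <-> P s) -> fs_closed c P -> flip_swap c S.
Proof.
move=> SP [Pflip Pswap]; split=> s s' Ts.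
- move=> [i [u [Es Es']]].
  have sz' : size (nseq i (~~ c) ++ ~~ c :: u) = n by rewrite -Es' size_tuple.
  have [cu|/notin_nseq Eu] := boolP (c \in u); last first.
    right; apply: val_inj; rewrite /= Es' Eu nseq_cat_cons -nseqD.
    have -> : i.+1 + size u = n by rewrite -sz' nseq_cat_cons size_cat size_nseq.
    rewrite [RHS](@notin_nseq c) ?size_map -?enumT ?size_enum_ord //.
    by apply/negP => /mapP[j _]; case: (c).
  left; apply/SP; rewrite Es'; apply: Pflip cu _.
  case: Ts => [/SP|Es0]; first by rewrite Es.
  have : c \in val s by rewrite /= Es mem_cat inE eqxx orbT.
  by rewrite Es0 => /mapP[j _]; case: (c).
- move=> [i [b [u [Es Es']]]].
  (* Swapping two equal bits changes nothing, which leaves [b = ~~ c]. *)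
  have [bc|/negPf bc] := eqVneq b c.
    by have -> : s' = s; [apply: val_inj; rewrite /= Es Es' bc | ].
  have {}bc : b = ~~ c by move: bc; case: (b); case: (c).
  left; apply/SP; rewrite Es' bc; apply: Pswap.
  case: Ts => [/SP|Es0]; first by rewrite Es bc.
  have : c \in val s by rewrite /= Es mem_cat inE eqxx orbT.
  by rewrite Es0 => /mapP[j _]; case: (c).
Qed.

(** Complementation turns the leftmost 0 into the leftmost 1, so operations with respect to 0 become
    operations with respect to 1. *)
Lemma flip_swap_compl n (S : n.-tuple bool -> Prop) (Q : seq bool -> Prop) :
  (forall s, S s <-> Q (map negb s)) -> fs_closed true Q -> flip_swap false S.
Proof.
move=> SQ [Qflip Qswap].
apply: (flip_swap_closed (P := fun s => Q (map negb s))) => //.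
split=> [i u uf|i u]; rewrite !map_cat !map_nseq /=; last exact: Qswap.
by apply: Qflip; rewrite -[true]/(~~ false) mem_map //; apply: negb_inj.
Qed.

(** * Lexicographic order and initial runs *)

Lemma lex_le_cons x y s t :
  lex_le (x :: s) (y :: t) = (~~ x && y) || (x == y) && lex_le s t.
Proof. by rewrite /lex_le lexi_cons; case: x y => -[]. Qed.

Lemma lex_lt_cons x y s t :
  lex_lt (x :: s) (y :: t) = (~~ x && y) || (x == y) && lex_lt s t.
Proof. by rewrite /lex_lt ltxi_cons; case: x y => -[]. Qed.

Lemma lex_lexx s : lex_le s s. Proof. exact: lexx. Qed.

Lemma lex_ltxx s : lex_lt s s = false. Proof. exact: ltxx. Qed.

Lemma lex_ltW s t : lex_lt s t -> lex_le s t. Proof. exact: ltW. Qed.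

Lemma lex_le_trans t s u : lex_le s t -> lex_le t u -> lex_le s u.
Proof. exact: le_trans. Qed.

Lemma lex_lt_le_trans t s u : lex_lt s t -> lex_le t u -> lex_lt s u.
Proof. exact: lt_le_trans. Qed.

Lemma lex_le_cat2l p s t : lex_le (p ++ s) (p ++ t) = lex_le s t.
Proof. by elim: p => //= x p IH; rewrite lex_le_cons eqxx IH; case: x. Qed.

Lemma lex_lt_cat2l p s t : lex_lt (p ++ s) (p ++ t) = lex_lt s t.
Proof. by elim: p => //= x p IH; rewrite lex_lt_cons eqxx IH; case: x. Qed.

(** Equal sizes exclude proper prefixes, which would stay smaller after complementation. *)
Lemma lex_compl s t : size s = size t ->
  (lex_le (map negb s) (map negb t) = lex_le t s)
  * (lex_lt (map negb s) (map negb t) = lex_lt t s).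
Proof.
elim: s t => [|x s IH] [|y t] //= [/IH IHt].
by rewrite !(lex_le_cons, lex_lt_cons) !IHt; case: x y => -[].
Qed.

Lemma lex_le_run a b s t :
  lex_le (nseq a false ++ true :: s) (nseq b false ++ true :: t) -> b <= a.
Proof. by elim: a b => [|a IH] [|b] //=; rewrite lex_le_cons //=; apply: IH. Qed.

Lemma lex_lt_run a b s t : b < a ->
  lex_lt (nseq a false ++ true :: s) (nseq b false ++ true :: t).
Proof. by elim: a b => [|a IH] [|b] //=; rewrite lex_lt_cons //=; apply: IH. Qed.

(** * Weight, lexicographic bounds and reversals *)

Lemma fs_true c : fs_closed c (fun=> True). Proof. by []. Qed.

Lemma fs_weight_le k : fs_closed true (fun s => ((weight s)%:Z <= k)%R).
Proof.
by rewrite /weight; split=> [i u _|i u]; rewrite !count_cat /=; lia.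
Qed.

Lemma fs_weight_ge k : fs_closed false (fun s => (k <= (weight s)%:Z)%R).
Proof.
by rewrite /weight; split=> [i u _|i u]; rewrite !count_cat /=; lia.
Qed.

Lemma fs_lex_le gamma : fs_closed true (fun s => lex_le s gamma).
Proof.
by split=> [i u _|i u]; apply: lex_le_trans; apply: lex_ltW; rewrite lex_lt_cat2l.
Qed.

Lemma fs_lex_ge gamma : fs_closed false (fun s => lex_le gamma s).
Proof.
by split=> [i u _|i u] /lex_le_trans; apply; apply: lex_ltW; rewrite lex_lt_cat2l.
Qed.

(** [R] stands for [lex_lt] or [lex_le]. The hypothesis bounds the final run of 0s by the initial
    one; an operation lengthens the initial run and never the final one, so the comparison becomes
    strict. *)
Lemma fs_rev (R : seq bool -> seq bool -> bool) :
  (forall s t, lex_lt s t -> R s t) -> (forall s t, R s t -> lex_le s t) ->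
  fs_closed true (fun s => R s (rev s)).
Proof.
have mem_rev_run u : true \in u -> exists a w, rev u = nseq a false ++ true :: w.
  by rewrite -mem_rev => /first_run.
move=> ltR Rle; split=> [i u uT /Rle H|i u /Rle H]; apply: ltR; move: H.
  have [a [w Eu]] := first_run uT; have [b [x Er]] := mem_rev_run u uT.
  rewrite !rev_cat !rev_cons Er !cat_rcons -!catA /= => /lex_le_run bi.
  rewrite Eu !nseq_cat_cons catA -nseqD; apply: lex_lt_run; lia.
rewrite !rev_cat !rev_cons !cat_rcons /= nseq_cat_cons rev_nseq.
have [uT|/notin_nseq ->] := boolP (true \in u).
  have [a [w Eu]] := first_run uT; have [b [x Er]] := mem_rev_run u uT.
  rewrite Er -!catA => /lex_le_run bi; apply: lex_lt_run; lia.
rewrite rev_nseq [in X in lex_le _ X]nseq_cat_cons => /lex_le_run bi.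
by apply: lex_lt_run; lia.
Qed.

(** A flip lowers the string and raises its complemented reversal. A swap lowers both, so their
    initial runs are compared; [Rdiag] settles the one case where both stay equal. *)
Lemma fs_comp_rev (R : seq bool -> seq bool -> bool) :
  (forall s t, lex_lt s t -> R s t) -> (forall s t, R s t -> lex_le s t) ->
  (forall s t, R s s -> R t t) ->
  fs_closed true (fun s => R s (comp_rev s)).
Proof.
move=> ltR Rle Rdiag; rewrite /comp_rev; split=> [i u _ /Rle H|i u].
  apply: ltR; apply: (@lex_lt_le_trans (nseq i false ++ true :: u)).
    by rewrite lex_lt_cat2l.
  apply: lex_le_trans H _.
  by rewrite !rev_cat !rev_cons !cat_rcons !map_cat lex_le_cat2l.
rewrite !rev_cat !rev_cons !cat_rcons !map_cat /= rev_nseq map_nseq /=.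
have [/first_run[a [w ->]] /Rle|] := boolP (true \in map negb (rev u)).
  rewrite -!catA nseq_cat_cons => /lex_le_run ai.
  by apply: ltR; apply: lex_lt_run.
move=> /notin_nseq Er H; move: (H); rewrite Er => /Rle /lex_le_run.
rewrite size_map size_rev leq_eqVlt => /orP[/eqP ui|ui]; last first.
  by rewrite !nseq_cat_cons; apply/ltR/lex_lt_run.
(* In the tie the old string is 0^i 1 0 1^i and the new one 0^(i+1) 1^(i+1); each is its own
   complemented reversal. *)
have Eu : u = nseq i true.
  have := congr1 (fun s => map negb (rev s)) Er.
  by rewrite -map_rev revK mapK ?rev_nseq ?map_nseq ?size_map ?size_rev ?ui //;
    apply: negbK.
by move: H; rewrite Er Eu size_map size_rev size_nseq; apply: Rdiag.
Qed.

(** * Inversions and transpositions *)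

(** Recursive form of [inversions], grouped by the left index; it is additive over concatenation up
    to a cross term. *)
Fixpoint invs (c : bool) (s : seq bool) : nat :=
  if s is x :: s' then (x == c) * count_mem (~~ c) s' + invs c s' else 0.

Lemma inversionsE c n (s : n.-tuple bool) : inversions c s = invs c s.
Proof.
have invs_sum m t : size t = m ->
    \sum_(i < m) \sum_(j < m)
      [&& i < j, nth c t i == c & nth c t j == ~~ c] = invs c t.
  elim: t m => [|x t IH] [] //= => [_|m [szt]]; first by rewrite big_ord0.
  rewrite big_ord_recl -(IH m) // big_ord_recl /= add0n.
  congr (_ + _).
    rewrite -sum1_count (big_nth c) szt big_mkord [in RHS]big_mkcond big_distrr.
    apply: eq_bigr => j _ /=.
    by case: (x == c) => //; case: (_ == ~~ c).
  apply: eq_bigr => i _; rewrite big_ord_recl /= add0n.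
  by apply: eq_bigr => j _.
rewrite /inversions -sum1dep_card -(invs_sum n) ?size_tuple // pair_big /=.
rewrite big_mkcond; apply: eq_bigr => -[i j] _ /=.
by rewrite !(tnth_nth c); case: ifP.
Qed.

Lemma invs_cat c s t :
  invs c (s ++ t) = invs c s + invs c t + count_mem c s * count_mem (~~ c) t.
Proof.
elim: s => [|x s IH]; first by rewrite mul0n addn0.
by rewrite /= IH count_cat; ring.
Qed.

Lemma invs_nseq c b i : invs c (nseq i b) = 0.
Proof.
by elim: i => //= i ->; rewrite count_nseq /=; case: b c => -[]; rewrite ?muln0.
Qed.

(** Only [~~ c] precedes the leftmost [c], so flipping it destroys its inversions and creates none;
    a swap with [~~ c] destroys exactly one. *)
Lemma fs_invs c k : fs_closed c (fun s => ((invs c s)%:Z <= k)%R).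
Proof.
by split=> [i u _|i u]; rewrite !invs_cat /= ?count_nseq;
  case: c => /=; nia.
Qed.

Lemma invs_two_runs c s : two_runs c s -> invs c s = 0.
Proof.
move=> [p [q ->]]; rewrite invs_cat !invs_nseq !count_nseq /=.
by case: c => /=; rewrite ?mul0n ?muln0.
Qed.

Lemma descent c s : two_runs c s \/ exists u v, s = u ++ c :: ~~ c :: v.
Proof.
elim: s => [|x s [[p [q ->]]|[u [v ->]]]]; first by left; exists 0, 0.
- have [->|/negPf xc] := eqVneq x (~~ c); first by left; exists p.+1, q.
  have {xc} -> : x = c by move: xc; case: (x); case: (c).
  case: p => [|p]; first by left; exists 0, q.+1.
  by right; exists [::], (nseq p (~~ c) ++ nseq q c).
by right; exists (x :: u), v.
Qed.

(** An adjacent transposition alters the relative order of one pair only. *)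
Lemma invs_adj_transp c s s' : adj_transp s s' -> invs c s <= (invs c s').+1.
Proof.
move=> [u [a [b [v [-> ->]]]]]; rewrite !invs_cat /=.
by case: a b c => -[] [] /=; nia.
Qed.

Lemma transp_into_ge c s m : transp_into (two_runs c) s m -> invs c s <= m.
Proof.
move=> [t tt]; elim: m s => [|m IH] s /=; first by move=> ->; rewrite invs_two_runs.
by move=> [s' /(invs_adj_transp c) ss' /IH s'm]; apply: leq_trans ss' _.
Qed.

(** Bubble sort: each transposition at a descent removes exactly one inversion. *)
Lemma transp_into_invs c s : transp_into (two_runs c) s (invs c s).
Proof.
move: {-2}(invs c s) (erefl (invs c s)) => m; elim: m s => [|m IH] s Em.
  exists s => //; have [//|[u [v Es]]] := descent c s.
  by move: Em; rewrite Es; case: (c); rewrite invs_cat /=; lia.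
have [/invs_two_runs|[u [v Es]]] := descent c s; first by rewrite -Em.
have [|t tt pt] := IH (u ++ ~~ c :: c :: v).
  by move: Em; rewrite Es; case: (c); rewrite !invs_cat /=; lia.
by exists t => //; exists (u ++ ~~ c :: c :: v) => //; exists u, c, (~~ c), v.
Qed.

Lemma num_transpE c s m : num_transp (two_runs c) s m <-> m = invs c s.
Proof.
split=> [[/transp_into_ge sm /(_ _ (transp_into_invs c s)) ms]|->].
  by apply/eqP; rewrite eqn_leq ms sm.
by split=> [|m' /transp_into_ge]; first exact: transp_into_invs.
Qed.

(** * Forbidden factors and prefix normal words *)

Lemma infix_nseq_cat (x y : bool) i u v : x != y ->
  infix (x :: u) (nseq i y ++ v) = infix (x :: u) v.
Proof.
move=> xy; elim: i => // i IH.
by rewrite [_ ++ _]/= infix_consl prefix_cons (negPf xy) IH.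
Qed.

Lemma prefix_nseq_cons (T : eqType) (x : T) t u :
  prefix (nseq t x) u -> prefix (nseq t x) (x :: u).
Proof.
elim: t u => // t IH [|y u] //; rewrite [nseq _ _]/= !prefix_cons eqxx.
by case/andP=> /eqP <- /IH.
Qed.

(** A forbidden factor starts with [c], so it cannot start in the initial run. If it starts at the
    swapped [c], it already occurred before the swap, where that [c] had one more [~~ c] behind
    it. *)
Lemma fs_forbidden_infix c t : fs_closed c (fun s => ~~ infix (c :: nseq t (~~ c)) s).
Proof.
have cN : c != ~~ c by case: c.
split=> [i u _|i u]; rewrite !infix_nseq_cat //; apply: contraNN.
  by rewrite !infix_consl prefix_cons (negPf cN) /= => ->; rewrite orbT.
rewrite !infix_consl !prefix_cons (negPf cN) eqxx andTb andFb orFb.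
by case/orP=> [/prefix_nseq_cons|] ->; rewrite ?orbT.
Qed.

Lemma fs_forbidden_prefix c gamma : fs_closed c (fun s => ~~ prefix (c :: gamma) s).
Proof.
have cN : c != ~~ c by case: c.
by split=> [[|i] u _|[|i] u] _; rewrite prefix_cons (negPf cN).
Qed.

(** A window overrunning the end of [s] is shorter than [l]; it is bounded by a shorter prefix,
    which [take l s] extends. *)
Lemma prefix_normalP c s : prefix_normal c s <->
  forall p l, count_mem c (take l (drop p s)) <= count_mem c (take l s).
Proof.
split=> [H p l|H u /infixP[x [y Es]]]; last first.
  by have := H (size x) (size u); rewrite {1}Es drop_size_cat // take_size_cat.
have := H (take l (drop p s)) (infix_trans (infix_take _ _) (infix_drop _ _)).
move=> /leq_trans; apply; rewrite size_take_min.
rewrite -(cat_take_drop (minn l (size (drop p s))) (take l s)).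
rewrite -take_min minnAC minnn.
by rewrite count_cat leq_addr.
Qed.

Lemma count_take_run (c x : bool) i l u : i < l ->
  count_mem c (take l (nseq i c ++ x :: u))
  = i + (x == c) + count_mem c (take (l - i.+1) u).
Proof.
move=> il; rewrite take_cat size_nseq ltnNge (ltnW il) /= -(subnSK il) /=.
by rewrite count_cat count_nseq /= eqxx mul1n addnA.
Qed.

Lemma count_take_short_run (c : bool) i l s u : l <= i ->
  count_mem c (take l s) <= count_mem c (take l (nseq i c ++ u)).
Proof.
move=> li; rewrite [in leqRHS]takel_cat ?size_nseq // take_nseq //.
rewrite count_nseq /= eqxx mul1n (leq_trans (count_size _ _)) //.
by rewrite size_take_min geq_minl.
Qed.

Lemma count_take_drop_flip (c : bool) p l s u :
  count_mem c (take l (drop p (s ++ c :: u)))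
  <= (count_mem c (take l (drop p (s ++ ~~ c :: u)))).+1.
Proof.
elim: s p l => [|x s IH] [|p] [|l] //=.
- by rewrite eqxx; case: (c).
- by have := IH 0 l; rewrite !drop0 -addnS leq_add2l.
Qed.

(** The moved [c] goes from index [i.+1] to index [i]. A window of length at least [i.+2] that
    covers index [i] also covers [i.+1], so it gains nothing. *)
Lemma count_take_drop_swap (c : bool) p l i u : i.+2 <= l ->
  count_mem c (take l (drop p (nseq i c ++ c :: ~~ c :: u)))
  <= count_mem c (take l (drop p (nseq i c ++ ~~ c :: c :: u))).
Proof.
elim: i p l => [|i IH] [|p] [|l] //=.
- by case: l => //= l _; case: (c).
- by case: p => //= _; case: (c).
- by move=> il; have := IH 0 l il; rewrite !drop0 leq_add2l.
by move=> il; apply: IH; lia.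
Qed.

(** Prefixes inside the new initial run consist of [c] only and are maximal. For longer ones, a flip
    adds one [c] to the prefix and at most one to any window; a swap keeps the prefix count and
    raises no window count. *)
Lemma fs_prefix_normal c : fs_closed (~~ c) (prefix_normal c).
Proof.
split=> [i u _|i u]; rewrite !prefix_normalP negbK => H p l.
  have [il|li] := ltnP i l; last first.
    by rewrite nseq_cat_cons; apply: count_take_short_run; lia.
  apply: leq_trans (count_take_drop_flip _ _ _ _ _) _.
  have := H p l; rewrite !count_take_run // eqxx; case: (c) => /=; lia.
have [il|li] := ltnP i.+1 l; last first.
  by rewrite nseq_cat_cons; apply: count_take_short_run.
apply: leq_trans (count_take_drop_swap _ _ _ il) _; apply: leq_trans (H p l) _.
rewrite !count_take_run ?(ltnW il) // -(subnSK il) /= eqxx.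
by case: (c) => /=; lia.
Qed.

Lemma transp_le c s k :
  (exists2 m : nat, num_transp (two_runs c) s m & (m%:Z <= k)%R)
  <-> ((invs c s)%:Z <= k)%R.
Proof.
by split=> [[m /num_transpE ->]//|ik]; exists (invs c s) => //; apply/num_transpE.
Qed.

(** * Necklaces *)

(* No run of 0s in u is longer than m; [take] stops at the end of u, so a final run
   of 0s is excluded altogether: in a necklace 0^m 1 u it would continue
   cyclically into the initial run. *)
Definition short_runs (m : nat) (u : seq bool) : Prop :=
  forall p, p < size u -> has id (take m.+1 (drop p u)).

Definition strict_necklace (s : seq bool) : Prop :=
  forall j, 0 < j < size s -> lex_lt s (rot j s).

Lemma has_take_run m d : has id (take m.+1 d) ->
  exists2 b, b <= m & exists w, d = nseq b false ++ true :: w.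
Proof.
elim: m d => [|m IH] [|[] d] //=; rewrite ?take0 //;
  try by move=> _; exists 0; last exists d.
by case/IH=> b bm [w ->]; exists b.+1 => //; exists w.
Qed.

Lemma has_take_run_le m b w :
  has id (take m.+1 (nseq b false ++ true :: w)) = (b <= m).
Proof. by elim: m b => [|m IH] [|b] //=; rewrite ?take0 -?IH. Qed.

Lemma short_runs_drop m j u : short_runs m u -> short_runs m (drop j u).
Proof.
by move=> H p; rewrite size_drop drop_drop => pj; apply: H; lia.
Qed.

Lemma short_runs_le m m' u : m <= m' -> short_runs m u -> short_runs m' u.
Proof.
move=> mm' H p /H /has_take_run[b bm [w ->]].
by rewrite has_take_run_le (leq_trans bm).
Qed.

(** The rotation starting at position [p] of [u] is not smaller than the necklace, so its initial
    run is no longer than [i]. *)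
Lemma necklace_short_runs i u :
  necklace_min (nseq i false ++ true :: u) -> short_runs i u.
Proof.
move=> H p pu; have := H (i.+1 + p).
have -> : rot (i.+1 + p) (nseq i false ++ true :: u)
          = drop p u ++ nseq i false ++ true :: take p u.
  rewrite -{1}(cat_take_drop p u) -cat_cons catA.
  have <- : size (nseq i false ++ true :: take p u) = i.+1 + p.
    by rewrite size_cat size_nseq /= size_take pu addnS.
  by rewrite rot_size_cat.
have [/first_run[b [w ->]]|/notin_nseq Ed] := boolP (true \in drop p u).
  by rewrite has_take_run_le -catA => /lex_le_run.
(* A final run of 0s would join the initial run cyclically and exceed [i]. *)
rewrite Ed catA -nseqD => /lex_le_run; rewrite -[leqRHS]add0n.
by rewrite leq_add2r size_drop leqn0 subn_eq0 leqNgt pu.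
Qed.

(** A rotation starting in the initial run or at the following 1 has lost some of its [m.+1] zeros;
    one starting in [w] begins with at most [m]. *)
Lemma short_runs_strict_necklace m w :
  short_runs m w -> strict_necklace (nseq m.+1 false ++ true :: w).
Proof.
move=> H j /andP[j0 js]; rewrite /rot.
have [jm|mj] := leqP j m.+1.
  rewrite -{2}(subnKC jm) nseqD -catA drop_size_cat ?size_nseq // -catA.
  by apply: lex_lt_run; lia.
rewrite drop_cat size_nseq ltnNge (ltnW mj) /= -(subnSK mj) /=.
have [|b bm [x ->]] := @has_take_run m (drop (j - m.+2) w).
  by apply: H; move: js; rewrite size_cat size_nseq /=; lia.
by rewrite -catA; apply: (@lex_lt_run m.+1).
Qed.

Lemma strict_necklace_min s : strict_necklace s -> necklace_min s.
Proof.
move=> H [|j]; first by rewrite rot0 lex_lexx.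
have [js|sj] := ltnP j.+1 (size s); first exact/lex_ltW/H.
by rewrite rot_oversize // lex_lexx.
Qed.

(** A proper power of [u] is fixed by rotation through [size u], against strictness. *)
Lemma strict_necklace_lyndon s : s != [::] -> strict_necklace s -> lyndon s.
Proof.
move=> s0 H; split; first exact: strict_necklace_min.
move=> u [|[|j]] // _ Es; have u0 : 0 < size u.
  by case: u Es s0 => // ->; elim: j.
suff: lex_lt s (rot (size u) s).
  rewrite {2}Es /= rot_size_cat.
  have -> : (u ++ flatten (nseq j u)) ++ u = s.
    rewrite Es /= -!catA; congr cat.
    by elim: j {Es} => [|j IH] /=; rewrite ?cats0 // -catA IH.
  by rewrite lex_ltxx.
apply: H; rewrite u0 Es /= !size_cat; lia.
Qed.

(** With 0^a the run before the next 1, the flip merges two runs into one of length [i + a + 1],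
    while later runs stay at most [i]. *)
Lemma necklace_flip i u : true \in u ->
  necklace_min (nseq i false ++ true :: u) ->
  strict_necklace (nseq i false ++ false :: u).
Proof.
move=> /first_run[a [w Eu]] /necklace_short_runs.
rewrite Eu => /(@short_runs_drop _ a.+1).
rewrite drop_cat size_nseq ltnNge leqnSn subSnn /= drop0.
move=> /(@short_runs_le _ (i + a)) H; rewrite nseq_cat_cons catA -nseqD addSn.
by apply/short_runs_strict_necklace/H; rewrite leq_addr.
Qed.

Lemma necklace_swap i u : necklace_min (nseq i false ++ true :: false :: u) ->
  strict_necklace (nseq i false ++ false :: true :: u).
Proof.
move=> /necklace_short_runs /(@short_runs_drop _ 1) /=; rewrite drop0.
by rewrite nseq_cat_cons; apply: short_runs_strict_necklace.
Qed.

Lemma cat_cons_neq_nil (T : eqType) (s : seq T) x u : s ++ x :: u != [::].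
Proof. by case: s. Qed.

Lemma fs_necklace : fs_closed true necklace_min.
Proof.
split=> [i u uT|i u] H; apply: strict_necklace_min.
  exact: necklace_flip.
exact: necklace_swap.
Qed.

Lemma fs_lyndon : fs_closed true lyndon.
Proof.
split=> [i u uT|i u] [H _]; apply: strict_necklace_lyndon (cat_cons_neq_nil _ _ _) _.
  exact: necklace_flip.
exact: necklace_swap.
Qed.

(** The operation is applied to the whole necklace extending the string. *)
Lemma fs_prenecklace : fs_closed true prenecklace_min.
Proof.
split=> [i u uT|i u] [w Hw /prefixP[v Ew]].
  exists (nseq i false ++ false :: u ++ v).
    apply: (proj1 fs_necklace); first by rewrite mem_cat uT.
    by move: Hw; rewrite Ew -catA.
  by rewrite -cat_cons catA prefix_prefix.
exists (nseq i false ++ false :: true :: u ++ v).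
  by apply: (proj2 fs_necklace); move: Hw; rewrite Ew -catA.
by rewrite -!cat_cons catA prefix_prefix.
Qed.

Lemma necklace_max_compl s : necklace_max s <-> necklace_min (map negb s).
Proof.
by split=> H i; have := H i; rewrite -map_rot lex_compl ?size_rot.
Qed.

Lemma map_negbK (s : seq bool) : map negb (map negb s) = s.
Proof. exact/mapK/negbK. Qed.

Lemma aperiodic_compl s : aperiodic s <-> aperiodic (map negb s).
Proof.
have aux t : aperiodic (map negb t) -> aperiodic t.
  move=> H u j j2 Et; apply: (H (map negb u) j j2).
  by rewrite Et map_flatten map_nseq.
by split; [rewrite -{1}(map_negbK s)|]; apply: aux.
Qed.

Lemma prefix_compl s t : prefix (map negb s) (map negb t) = prefix s t.
Proof.
have aux u v : prefix u v -> prefix (map negb u) (map negb v).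
  by move=> /prefixP[w ->]; rewrite map_cat prefix_prefix.
by apply/idP/idP => [/aux|/aux //]; rewrite !map_negbK.
Qed.

Lemma prenecklace_max_compl s : prenecklace_max s <-> prenecklace_min (map negb s).
Proof.
split=> [[w Hw sw]|[w Hw sw]]; exists (map negb w).
- exact/necklace_max_compl.
- by rewrite prefix_compl.
- by apply/necklace_max_compl; rewrite map_negbK.
- by rewrite -prefix_compl map_negbK.
Qed.

(** * Pseudo-necklaces *)

Lemma block_word_compl c B : map negb (block_word c B) = block_word (~~ c) B.
Proof. by rewrite /block_word map_cat !map_nseq. Qed.

Lemma pseudo_necklace_compl c s :
  pseudo_necklace c s <-> pseudo_necklace (~~ c) (map negb s).
Proof.
have aux b t : pseudo_necklace b t -> pseudo_necklace (~~ b) (map negb t).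
  move=> [B [Bs [[-> srt] le]]]; exists B, Bs; split=> //; split=> //.
  by rewrite map_flatten -map_comp (eq_map (block_word_compl b)).
by split=> [|/aux]; [exact: aux | rewrite negbK map_negbK].
Qed.

(** All blocks have first runs of length at most [i], that of the first block. An operation makes
    the first block start with more than [i] zeros, so it precedes the others whatever its number of
    1s. *)
Lemma fs_pseudo_necklace : fs_closed true (pseudo_necklace true).
Proof.
have le_run B B' : block_le B B' -> B'.1 <= B.1.
  by rewrite /block_le /block_lt => /orP[/eqP ->|] //; lia.
have le_longer B B' : B'.1 < B.1 -> block_le B B'.
  by rewrite /block_le /block_lt => ->; rewrite orbT.
pose adj (B B' : nat * nat) := (0 < B.2) && (0 < B'.1).
have path_head B B' Bs : (0 < B.2 -> 0 < B'.2) -> path adj B Bs -> path adj B' Bs.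
  by case: Bs => //= B'' Bs bb' /andP[/andP[/bb' b' a] p]; rewrite /adj b' a.
have init i u B Bs : block_decomposition true (nseq i false ++ true :: u) (B :: Bs) ->
    all (block_le B) Bs ->
  exists t, [/\ u = nseq t true ++ flatten (map (block_word true) Bs),
    path adj (i, t.+1) Bs & all (fun B => B.1 <= i) Bs].
  (* A first block without 1s would, by maximality, be the only block, and the string would have no
     1. *)
  case: B => a b [/=]; case: b => [|b] Es srt le.
    case: Bs srt Es {le} => [_|B Bs] //=.
    rewrite /block_word /= !cats0 => Es.
    have : true \in nseq a false by rewrite -Es mem_cat inE eqxx orbT.
    by rewrite mem_nseq andbF.
  move: Es; rewrite /block_word /= -catA => /(@first_run_inj true)[ia ->].
  rewrite -ia in srt le.
  by exists b; split=> //; apply: sub_all le => B /le_run.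
split=> [i u uT|i u] [B [Bs [dec le]]];
  have [t [Eu srt {}le]] := init _ _ _ _ dec le.
  case: t Eu srt => [|t] Eu srt.
    (* The flipped 1 was the only one in its block, so the block merges with the next. *)
    case: Bs Eu srt le {dec} => [|[a b] Bs] /= Eu srt le.
      by rewrite Eu in uT.
    exists (i.+1 + a, b), Bs; split.
      split; first by rewrite Eu nseq_cat_cons /block_word /= nseqD -!catA.
      by move/andP: srt => [_]; apply: path_head.
    apply: sub_all (proj2 (andP le)) => B' B'i; apply: le_longer => /=; lia.
  exists (i.+1, t.+1), Bs; split; last first.
    by apply: sub_all le => B' B'i; apply: le_longer.
  split; first by rewrite Eu nseq_cat_cons /block_word /= -!catA.
  exact: path_head srt.
case: t Eu srt => [|t] //= Eu srt.
(* The swap takes one 0 from the second block: if it was the only one, the blocks merge; otherwise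
   both remain. *)
case: Bs Eu srt le {dec} => [|[[|[|a]] b] Bs] //= Eu srt le.
  exists (i.+1, b.+1), Bs; split.
    split; last exact: path_head srt.
    by case: Eu => ->; rewrite nseq_cat_cons /block_word /= -!catA.
  by apply: sub_all (proj2 (andP le)) => B' B'i; apply: le_longer.
exists (i.+1, 1), ((a.+1, b) :: Bs); split.
  split; last exact: path_head srt.
  by case: Eu => ->; rewrite nseq_cat_cons /block_word /= -!catA.
apply/andP; split; first by apply: le_longer => /=; case/andP: le => /=; lia.
by apply: sub_all (proj2 (andP le)) => B' B'i; apply: le_longer.
Qed.

(** * Dyck words and knapsacks *)

Lemma count_take_set (c : bool) l s u :
  count_mem c (take l (s ++ ~~ c :: u)) <= count_mem c (take l (s ++ c :: u)).
Proof.
elim: s l => [|x s IH] [|l] //=; last by rewrite leq_add2l.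
by rewrite leq_add2r eqxx; case: (_ == _).
Qed.

Lemma count_take_advance (c : bool) l s u :
  count_mem c (take l (s ++ ~~ c :: c :: u))
  <= count_mem c (take l (s ++ c :: ~~ c :: u)).
Proof.
elim: s l => [|x s IH] [|l] //=; last by rewrite leq_add2l.
by case: l => //=; case: (c).
Qed.

Lemma count_mem_negb (c : bool) s : count_mem c s + count_mem (~~ c) s = size s.
Proof. by elim: s => //= x s <-; case: x; case: (c) => /=; lia. Qed.

Lemma dyck_left_factorP c k s : 0 < k ->
  dyck_left_factor c k s <->
  forall l, count_mem (~~ c) (take l s) <= k.-1 * count_mem c (take l s).
Proof.
move=> k0; split=> [[w [t [_ _ _ H]] sw] l|H].
  exact/H/(prefix_trans (prefix_take _ _)).
(* Padding with [m] copies of [~~ c] completes a Dyck word: the whole word meets the bound exactly,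
   so prefixes ending in the padding respect it. *)
set m := k.-1 * count_mem c s - count_mem (~~ c) s.
have Hs : count_mem (~~ c) s <= k.-1 * count_mem c s.
  by have := H (size s); rewrite take_size.
have cN : (~~ c == c) = false by case: (c).
exists (s ++ nseq m (~~ c)); last exact: prefix_prefix.
exists (count_mem c s); split.
- rewrite size_cat size_nseq -(count_mem_negb c) -addnA subnKC // -mulSn.
  by rewrite prednK // mulnC.
- by rewrite count_cat count_nseq /= cN addn0.
- by rewrite count_cat count_nseq /= eqxx mul1n subnKC // mulnC.
move=> u; rewrite prefixE => /eqP <-; move: (size u) => l.
rewrite take_cat; case: ifP => _; first exact: H.
rewrite !count_cat; set v := take _ _.
have vm : count_mem (~~ c) v <= m.
  by rewrite (leq_trans (count_size _ _)) // size_take_min size_nseq geq_minr.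
by rewrite (leq_trans (leq_add (leqnn _) vm)) // subnKC // leq_mul2l leq_addr orbT.
Qed.

(** Either operation lets every prefix lose only [~~ c] and gain only [c]. *)
Lemma fs_dyck_left_factor c k : fs_closed (~~ c) (dyck_left_factor c k).
Proof.
(* For [k = 0] the prefix condition would admit nonempty runs of [c], but only the empty string is a
   left factor. *)
have [->|k0] := posnP k.
  have nil s : dyck_left_factor c 0 s -> s = [::].
    move=> [w [t [sz _ _ _]] /prefixP[v Ew]].
    by apply: size0nil; move: sz; rewrite muln0 Ew size_cat; lia.
  by split=> [[|i] u _|[|i] u] /nil.
split=> [i u _|i u]; rewrite !dyck_left_factorP // negbK => H l.
  apply: leq_trans (leq_trans (H l) _).
    by have := count_take_set (~~ c) l (nseq i c) u; rewrite negbK.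
  by rewrite leq_mul2l count_take_set orbT.
apply: leq_trans (leq_trans (H l) _).
  by have := count_take_advance (~~ c) l (nseq i c) u; rewrite negbK.
by rewrite leq_mul2l count_take_advance orbT.
Qed.

(** Weights are indexed by [nat] so that the tail of a string uses the shifted weights. *)
Fixpoint load (R : nmodType) (w : nat -> R) (s : seq bool) : R :=
  if s is b :: s' then (w 0 *+ b + load (fun i => w i.+1) s')%R else 0%R.

Lemma load_sum (R : nmodType) (w : nat -> R) n (s : n.-tuple bool) :
  load w s = (\sum_(i < n) w i *+ tnth s i)%R.
Proof.
elim: n w s => [|n IH] w s; first by rewrite tuple0 big_ord0.
case/tupleP: s => b s; rewrite big_ord_recl /= tnth0 IH.
by congr (_ + _)%R; apply: eq_bigr => i _; rewrite tnthS.
Qed.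

(** A flip removes an item; a swap with 0 replaces an item by the next one, which is no heavier. *)
Lemma fs_load (R : realDomainType) (w : nat -> R) W :
  (forall i, (0 <= w i)%R) -> (forall i, (w i.+1 <= w i)%R) ->
  fs_closed true (fun s => (load w s <= W)%R).
Proof.
move=> w0 wS.
have load_nseq i : forall (w' : nat -> R) s,
    load w' (nseq i false ++ s) = load (fun j => w' (i + j)%N) s.
  by elim: i => //= i IH w' s; rewrite mulr0n add0r IH.
split=> [i u _|i u]; rewrite !load_nseq /= !addn0 ?addn1; apply: le_trans;
  rewrite !(mulr0n, mulr1n, add0r).
  by rewrite lerDr.
by rewrite lerD2r.
Qed.

(** The default 0 beyond the last item keeps the weights nonnegative and nonincreasing. *)
Definition item_weight_ext (R : realDomainType) n (K : knapsack R n) (i : nat)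
    : R :=
  oapp (item_weight K) 0%R (insub i).

Lemma feasible_solutionE (R : realDomainType) n (K : knapsack R n)
    (s : n.-tuple bool) :
  feasible_solution K s <-> (load (item_weight_ext K) s <= capacity K)%R.
Proof.
have loadE : load (item_weight_ext K) s
    = (\sum_(i | tnth s i) item_weight K i)%R.
  rewrite load_sum [RHS]big_mkcond; apply: eq_bigr => i _.
  by rewrite /item_weight_ext valK; case: (tnth s i).
rewrite loadE; split=> [[A feasA Es]|sW].
  suff -> : (\sum_(i | tnth s i) item_weight K i
              = \sum_(i in A) item_weight K i)%R by [].
  by apply: eq_bigl => i; rewrite Es tnth_mktuple.
exists [set i | tnth s i]; last first.
  by apply: eq_from_tnth => i; rewrite tnth_mktuple inE.
by rewrite /feasible; under eq_bigl do rewrite inE.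
Qed.

Lemma fs_knapsack (R : realDomainType) n (K : knapsack R n) :
  fs_closed true (fun s => (load (item_weight_ext K) s <= capacity K)%R).
Proof.
have w0 i : (0 <= item_weight_ext K i)%R.
  by rewrite /item_weight_ext; case: insub => //= j; apply: item_weight_ge0.
apply: fs_load => // i; have [iS|iS] := ltnP i.+1 n; last first.
  by rewrite {1}/item_weight_ext insubF // ltnNge iS.
rewrite /item_weight_ext (insubT (fun j => j < n) iS).
rewrite (insubT (fun j => j < n) (ltnW iS)).
exact: item_weight_sorted.
Qed.

Theorem theorem1 (n : nat) :
  (* flip-swap languages with respect to 1 *)
  ( flip_swap true (fun s : n.-tuple bool => True)                          (* i *)
  /\ (forall k : int,
        flip_swap true (fun s : n.-tuple bool => ((weight s)%:Z <= k)%R))    (* ii *)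
  /\ (forall gamma : seq bool,
        flip_swap true (fun s : n.-tuple bool => lex_le s gamma))            (* iii *)
  /\ (forall k : int,
        flip_swap true
          (fun s : n.-tuple bool => ((inversions true s)%:Z <= k)%R))        (* iv *)
  /\ (forall k : int,
        flip_swap true
          (fun s : n.-tuple bool =>
             exists2 m : nat, num_transp (two_runs true) s m & (m%:Z <= k)%R)) (* v *)
  /\ flip_swap true (fun s : n.-tuple bool => lex_lt s (rev s))             (* vi *)
  /\ flip_swap true (fun s : n.-tuple bool => lex_le s (rev s))             (* vii *)
  /\ flip_swap true (fun s : n.-tuple bool => lex_lt s (comp_rev s))        (* viii *)
  /\ flip_swap true (fun s : n.-tuple bool => lex_le s (comp_rev s))        (* ix *)
  /\ (forall t : nat,
        flip_swap true
          (fun s : n.-tuple bool => ~~ infix (true :: nseq t false) s))      (* x *)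
  /\ (forall gamma : seq bool,
        flip_swap true
          (fun s : n.-tuple bool => ~~ prefix (true :: gamma) s))            (* xi *)
  /\ flip_swap true (fun s : n.-tuple bool => prefix_normal false s)        (* xii *)
  /\ flip_swap true (fun s : n.-tuple bool => necklace_min s)               (* xiii *)
  /\ flip_swap true (fun s : n.-tuple bool => lyndon s)                     (* xiv *)
  /\ flip_swap true (fun s : n.-tuple bool => prenecklace_min s)            (* xv *)
  /\ flip_swap true (fun s : n.-tuple bool => pseudo_necklace true s)       (* xvi *)
  /\ (forall k : nat,
        flip_swap true
          (fun s : n.-tuple bool => dyck_left_factor false k s))             (* xvii *)
  /\ (forall (R : realDomainType) (K : knapsack R n),
        flip_swap true (fun s : n.-tuple bool => feasible_solution K s)))    (* xviii *)
  /\
  (* flip-swap languages with respect to 0 *)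
  ( flip_swap false (fun s : n.-tuple bool => True)                         (* 1 *)
  /\ (forall k : int,
        flip_swap false (fun s : n.-tuple bool => (k <= (weight s)%:Z)%R))   (* 2 *)
  /\ (forall gamma : seq bool,
        flip_swap false (fun s : n.-tuple bool => lex_le gamma s))           (* 3 *)
  /\ (forall k : int,
        flip_swap false
          (fun s : n.-tuple bool => ((inversions false s)%:Z <= k)%R))       (* 4 *)
  /\ (forall k : int,
        flip_swap false
          (fun s : n.-tuple bool =>
             exists2 m : nat, num_transp (two_runs false) s m & (m%:Z <= k)%R)) (* 5 *)
  /\ flip_swap false (fun s : n.-tuple bool => lex_lt (rev s) s)            (* 6 *)
  /\ flip_swap false (fun s : n.-tuple bool => lex_le (rev s) s)            (* 7 *)
  /\ flip_swap false (fun s : n.-tuple bool => lex_lt (comp_rev s) s)       (* 8 *)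
  /\ flip_swap false (fun s : n.-tuple bool => lex_le (comp_rev s) s)       (* 9 *)
  /\ (forall t : nat,
        flip_swap false
          (fun s : n.-tuple bool => ~~ infix (false :: nseq t true) s))      (* 10 *)
  /\ (forall gamma : seq bool,
        flip_swap false
          (fun s : n.-tuple bool => ~~ prefix (false :: gamma) s))           (* 11 *)
  /\ flip_swap false (fun s : n.-tuple bool => prefix_normal true s)        (* 12 *)
  /\ flip_swap false (fun s : n.-tuple bool => necklace_max s)              (* 13 *)
  /\ flip_swap false (fun s : n.-tuple bool => necklace_max s /\ aperiodic s) (* 14 *)
  /\ flip_swap false (fun s : n.-tuple bool => prenecklace_max s)           (* 15 *)
  /\ flip_swap false (fun s : n.-tuple bool => pseudo_necklace false s)     (* 16 *)
  /\ (forall k : nat,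
        flip_swap false
          (fun s : n.-tuple bool => dyck_left_factor true k s))).            (* xvii, 1 opening *)
Proof.
split.
- split; first exact: flip_swap_closed (fs_true _).
  split; first by move=> k; apply: flip_swap_closed (fs_weight_le k).
  split; first by move=> gamma; apply: flip_swap_closed (fs_lex_le gamma).
  split.
    by move=> k; apply: flip_swap_closed (fs_invs _ k) => s; rewrite inversionsE.
  split.
    by move=> k; apply: flip_swap_closed (fs_invs _ k) => s; apply: transp_le.
  split.
    apply: flip_swap_closed (fs_rev (R := lex_lt) _ lex_ltW) => //.
  split; first exact: flip_swap_closed (fs_rev lex_ltW _).
  split.
    apply: flip_swap_closed (fs_comp_rev (R := lex_lt) _ lex_ltW _) => // s t.
    by rewrite lex_ltxx.
  split.
    apply: flip_swap_closed (fs_comp_rev lex_ltW _ _) => // s t _.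
    exact: lex_lexx.
  split; first by move=> t; apply: flip_swap_closed (fs_forbidden_infix true t).
  split; first by move=> gamma; apply: flip_swap_closed (fs_forbidden_prefix true gamma).
  split; first exact: flip_swap_closed (fs_prefix_normal false).
  split; first exact: flip_swap_closed fs_necklace.
  split; first exact: flip_swap_closed fs_lyndon.
  split; first exact: flip_swap_closed fs_prenecklace.
  split; first exact: flip_swap_closed fs_pseudo_necklace.
  split; first by move=> k; apply: flip_swap_closed (fs_dyck_left_factor false k).
  by move=> R K; apply: flip_swap_closed (fs_knapsack K) => s; apply: feasible_solutionE.
split; first exact: flip_swap_closed (fs_true _).
split; first by move=> k; apply: flip_swap_closed (fs_weight_ge k).
split; first by move=> gamma; apply: flip_swap_closed (fs_lex_ge gamma).
split.
  by move=> k; apply: flip_swap_closed (fs_invs _ k) => s; rewrite inversionsE.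
split.
  by move=> k; apply: flip_swap_closed (fs_invs _ k) => s; apply: transp_le.
(* Complementation commutes with reversal and reverses the order, so the comparisons with respect to
   0 follow from those with respect to 1. *)
split.
  apply: flip_swap_compl (fs_rev (R := lex_lt) _ lex_ltW) => // s.
  by rewrite -map_rev lex_compl ?size_rev.
split.
  apply: flip_swap_compl (fs_rev lex_ltW _) => // s.
  by rewrite -map_rev lex_compl ?size_rev.
split.
  apply: flip_swap_compl (fs_comp_rev (R := lex_lt) _ lex_ltW _) => // s.
    by rewrite /comp_rev -map_rev lex_compl ?size_map ?size_rev.
  by move=> t; rewrite lex_ltxx.
split.
  apply: flip_swap_compl (fs_comp_rev lex_ltW _ _) => // s.
    by rewrite /comp_rev -map_rev lex_compl ?size_map ?size_rev.
  by move=> t _; apply: lex_lexx.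
split; first by move=> t; apply: flip_swap_closed (fs_forbidden_infix false t).
split; first by move=> gamma; apply: flip_swap_closed (fs_forbidden_prefix false gamma).
split; first exact: flip_swap_closed (fs_prefix_normal true).
split.
  exact: flip_swap_compl (fun s => necklace_max_compl s) fs_necklace.
split.
  apply: flip_swap_compl fs_lyndon => // s.
  by have := necklace_max_compl s; have := aperiodic_compl s; rewrite /lyndon; tauto.
split.
  exact: flip_swap_compl (fun s => prenecklace_max_compl s) fs_prenecklace.
split.
  exact: flip_swap_compl (fun s => pseudo_necklace_compl false s) fs_pseudo_necklace.
by move=> k; apply: flip_swap_closed (fs_dyck_left_factor true k).
Qed.
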